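(* Let $G$ be a connected graph with $n(G)\ge 5$ vertices and clique number $\omega(G)\le n(G)-3$. Then $\dim_l(G)\le n(G)-3$. Moreover, equality $\dim_l(G)=n(G)-3$ holds if and only if $G$ is isomorphic to the cycle $C_5$ or to $K_{n(G)}^{-}(\lambda,\mu)$ for some integers $\lambda\ge\mu\ge 2$ with $\lambda+\mu<n(G)$.
   Context: All graphs are finite and simple. $n(G)$ is the number of vertices and $\omega(G)$ the clique number of $G$. For vertices $x,y$ of a connected graph $G$, $d_G(x,y)$ is the length of a shortest $x,y$-path. A vertex $w$ distinguishes vertices $u,v$ if $d_G(u,w)\neq d_G(v,w)$. A set $W\subseteq V(G)$ is a local resolving set of $G$ if for every pair of adjacent vertices $u,v\in V(G)\setminus W$ some vertex of $W$ distinguishes $u$ and $v$. The local metric dimension $\dim_l(G)$ is the minimum cardinality of a local resolving set of $G$. For $n\ge 3$ and $1\le\mu\le\lambda$ with $\lambda+\mu\le n-1$, $K_n^{-}(\lambda,\mu)$ denotes the graph obtained from $K_n$ by deleting all edges of a subgraph isomorphic to $K_{\lambda,\mu}$ (well defined up to isomorphism). *)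

(* Defs.v *)
(* Simple graphs as symmetric irreflexive relations on a finType. *)
From mathcomp Require Import ssreflect ssrfun ssrbool eqtype ssrnat seq choice div fintype finset bigop fingraph.
Set Implicit Arguments. Unset Strict Implicit. Unset Printing Implicit Defensive.

Section Graphs.
Variables (T : finType) (e : rel T).

Definition connected_graph : Prop := forall x y : T, connect e x y.

Fixpoint walkn (k : nat) (x y : T) : bool :=
  if k is k'.+1 then [exists z, e x z && walkn k' z y] else x == y.

(* distance: least k with a walk of length k from x to y (searching k < #|T|,
   which suffices in a connected graph) *)
Definition dist (x y : T) : nat := find (fun k => walkn k x y) (iota 0 #|T|).

Definition distinguishes (w u v : T) : bool := dist u w != dist v w.

Definition clique (A : {set T}) : bool :=
  [forall x in A, forall y in A, (x != y) ==> e x y].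

Definition clique_number : nat := \max_(A : {set T} | clique A) #|A|.

Definition local_resolving (W : {set T}) : bool :=
  [forall u, forall v, [&& u \notin W, v \notin W & e u v] ==>
     [exists w in W, distinguishes w u v]].

Definition local_metric_dim : nat :=
  \big[minn/#|T|]_(W : {set T} | local_resolving W) #|W|.

End Graphs.

Definition isomorphic (T T' : finType) (e : rel T) (e' : rel T') : Prop :=
  exists f : T -> T', bijective f /\ forall x y, e' (f x) (f y) = e x y.

Definition C5 : rel 'I_5 :=
  fun i j => ((i.+1 %% 5) == j) || ((j.+1 %% 5) == i).

(* K_n^-(lam, mu): K_n on 'I_n minus the edges of K_{lam,mu} with parts
   A = {0..lam-1}, B = {lam..lam+mu-1} *)
Definition Kminus (n lam mu : nat) : rel 'I_n :=
  fun i j =>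
    let inA (k : 'I_n) := k < lam in
    let inB (k : 'I_n) := (lam <= k) && (k < lam + mu) in
    (i != j) && ~~ ((inA i && inB j) || (inB i && inA j)).
Arguments Kminus : clear implicits.

(* Main.v *)
(** Call a set S of vertices good if its complement is local resolving; the
    dimension is n minus the largest size of a good set.  If every adjacent pair
    in S has a vertex outside S adjacent to exactly one of the two, then S is
    good, and this property passes from an induced subgraph to the graph.  So a
    graph without good 4-sets has only finitely many possible induced subgraphs
    of each order, which can be enumerated.

    The clique condition says that the complement of G has no vertex cover of
    size 2, hence contains K4, 3K2, K3 + K2 or C5.  On the at most 6 vertices of
    such a subgraph, the absence of good 4-sets leaves five patterns in G.
    Two of them (2K2 + K1 and K2 + P3) make G disconnected: the K2 stays
    separated from the rest.  The induced C5 admits no further vertex.  Two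
    triangles joined by one edge, or by two edges at a common vertex, give a good
    4-set, this time with a pair separated by distances 2 and 3.  Finally, if G
    contains an induced 2K3, every further vertex sees exactly one of the
    triangles or both, which makes G two disjoint cliques plus vertices adjacent
    to everything. *)
Require Import Defs.
From mathcomp Require Import ssreflect ssrfun ssrbool eqtype ssrnat seq choice div fintype finset bigop fingraph.
Set Implicit Arguments. Unset Strict Implicit. Unset Printing Implicit Defensive.

(** * Finite patterns *)

(** A pair in neither list is left open, so that patterns can describe partial information. Pairs
    have their smaller vertex first, since only the strict upper triangle is read from [cell]. *)
Record pattern := Pattern {
  order : nat; edges : seq (nat * nat); nonedges : seq (nat * nat) }.

Definition pairs k := [seq (i, j) | j <- iota 0 k, i <- iota 0 j].

Definition induced k E := Pattern k E [seq p <- pairs k | p \notin E].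

Definition extension k E N (h : pattern) :=
  Pattern k (edges h ++ E) (nonedges h ++ N).

(* [has] and [all] that stop early under [vm_compute], unlike those of [seq],
   where the strict function [orb] or [andb] receives the recursive call. *)
Fixpoint some (X : Type) (a : pred X) s :=
  if s is x :: s' then if a x then true else some a s' else false.

Fixpoint every (X : Type) (a : pred X) s :=
  if s is x :: s' then if a x then every a s' else false else true.

Lemma someE X (a : pred X) s : some a s = has a s.
Proof. by elim: s => //= x s ->; case: (a x). Qed.

Lemma everyE X (a : pred X) s : every a s = all a s.
Proof. by elim: s => //= x s ->; case: (a x). Qed.

Definition matches (X : Type) (r : rel X) x0 (h : pattern) (s : seq X) :=
  if every (fun p => r (nth x0 s p.1) (nth x0 s p.2)) (edges h)
  then every (fun p => ~~ r (nth x0 s p.1) (nth x0 s p.2)) (nonedges h)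
  else false.

Definition cell (h : pattern) i j : option bool :=
  if (i, j) \in edges h then Some true
  else if (i, j) \in nonedges h then Some false else None.

(** Row [m] holds the columns beyond [m], so the rows shrink and the last one is empty, in the same
    shape as [code]. *)
Fixpoint template (c : nat -> nat -> option bool) m k :=
  if k is k'.+1 then [seq c m j | j <- iota m.+1 k'] :: template c m.+1 k'
  else [::].

Fixpoint row_fillings (t : seq (option bool)) : seq (seq bool) :=
  if t is o :: t' then
    if o is Some b then map (cons b) (row_fillings t')
    else map (cons true) (row_fillings t') ++ map (cons false) (row_fillings t')
  else [:: [::]].

Fixpoint fillings (t : seq (seq (option bool))) : seq (seq (seq bool)) :=
  if t is row :: t' then [seq x :: y | x <- row_fillings row, y <- fillings t']
  else [:: [::]].

(* A relation on [0 .. k-1] is coded by the part of its matrix strictly above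
   the diagonal, row by row. *)
Fixpoint adj (c : seq (seq bool)) i j : bool :=
  match c, i, j with
  | row :: _, 0, j'.+1 => nth false row j'
  | row :: _, i'.+1, 0 => nth false row i'
  | _ :: c', i'.+1, j'.+1 => adj c' i' j'
  | _, _, _ => false
  end.

Fixpoint code (X : Type) (r : rel X) (s : seq X) : seq (seq bool) :=
  if s is x :: s' then map (r x) s' :: code r s' else [::].

Fixpoint combinations (m : nat) (l : seq nat) : seq (seq nat) :=
  match m, l with
  | 0, _ => [:: [::]]
  | _, [::] => [::]
  | m'.+1, x :: l' => map (cons x) (combinations m' l') ++ combinations m l'
  end.

Fixpoint arrangements (m : nat) (l : seq nat) : seq (seq nat) :=
  if m is m'.+1 then [seq x :: t | x <- l, t <- arrangements m' (rem x l)]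
  else [:: [::]].

Definition separated (r : rel nat) k (l : seq nat) :=
  every (fun u => every (fun v => if r u v then
    some (fun w => if r u w == r v w then false else w \notin l) (iota 0 k)
    else true) l) l.

Definition unseparated r k := ~~ some (separated r k) (combinations 4 (iota 0 k)).

Definition has_pattern (r : rel nat) k h :=
  some (matches r 0 h) (arrangements (order h) (iota 0 k)).

(** All completions of the open pairs of [h] are tried. With [xpred0] and an empty list the
    statement says that [h] cannot occur in a graph without good 4-sets. *)
Definition forces (h : pattern) (P : rel nat -> bool) (hs : seq pattern) :=
  every (fun c => if unseparated (adj c) (order h) then
    if P (adj c) then true else some (has_pattern (adj c) (order h)) hs
    else true) (fillings (template (cell h) 0 (order h))).

(** The four [co_] patterns record nonedges only: they are subgraphs of the complement, not
    necessarily induced ones. *)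
Definition co_K4 := Pattern 4 [::] (pairs 4).
Definition co_3K2 := Pattern 6 [::] [:: (0,1); (2,3); (4,5)].
Definition co_K3_K2 := Pattern 5 [::] [:: (0,1); (0,2); (1,2); (3,4)].
Definition co_C5 := Pattern 5 [::] [:: (0,1); (1,2); (2,3); (3,4); (0,4)].

Definition ind_2K2_K1 := induced 5 [:: (0,1); (2,3)].
Definition ind_K2_P3 := induced 5 [:: (0,1); (2,3); (3,4)].
Definition ind_C5 := induced 5 [:: (0,1); (1,2); (2,3); (3,4); (0,4)].
Definition ind_2K3 := induced 6 [:: (0,1); (0,2); (1,2); (3,4); (3,5); (4,5)].

(* The triangles [0 1 2] and [3 4 5] are joined by the edge [0 5] and possibly
   by [2 5]. *)
Definition linked_2K3 :=
  Pattern 6 [:: (0,1); (0,2); (1,2); (3,4); (3,5); (4,5); (0,5)]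
            [:: (0,3); (0,4); (1,3); (1,4); (2,3); (2,4); (1,5)].

Definition core_patterns :=
  [:: ind_2K2_K1; ind_K2_P3; ind_C5; ind_2K3; linked_2K3].

Definition nbr_types := [:: [:: 0; 1; 2]; [:: 3; 4; 5]; iota 0 6].

(** The new vertices 6 and 7 see exactly [t] and [u] in the two triangles; the pair of 6 and 7 alone
    stays open. *)
Definition ind_2K3_ext (t u : seq nat) :=
  extension 8 ([seq (i, 6) | i <- t] ++ [seq (i, 7) | i <- u])
    ([seq (i, 6) | i <- iota 0 6 & i \notin t] ++
     [seq (i, 7) | i <- iota 0 6 & i \notin u]) ind_2K3.

(** * Enumerations over the completions of the patterns *)

Lemma forces_co_K4 : forces co_K4 xpred0 [::].
Proof. by vm_compute. Qed.

Lemma forces_co_K3_K2 : forces co_K3_K2 xpred0 core_patterns.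
Proof. by vm_compute. Qed.

Lemma forces_co_C5 : forces co_C5 xpred0 core_patterns.
Proof. by vm_compute. Qed.

Lemma forces_co_3K2 : forces co_3K2 xpred0 core_patterns.
Proof. by vm_compute. Qed.

Lemma forces_C5_vertex : forces (extension 6 [::] [::] ind_C5) xpred0 [::].
Proof. by vm_compute. Qed.

(** Vertices 0 and 1 are a K2 of the pattern and 5 is the new vertex: a neighbour of the K2 must see
    all of it and nothing else of the pattern. *)
Definition K2_nbr (r : rel nat) :=
  (r 0 5 == r 1 5) && (r 0 5 ==> [&& ~~ r 2 5, ~~ r 3 5 & ~~ r 4 5]).

Lemma forces_K2_P3_vertex :
  forces (extension 6 [::] [::] ind_K2_P3) K2_nbr [::].
Proof. by vm_compute. Qed.

Lemma forces_2K2_K1_vertex :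
  forces (extension 6 [::] [::] ind_2K2_K1) K2_nbr [:: ind_K2_P3].
Proof. by vm_compute. Qed.

Definition K2_path :=
  extension 7 [:: (0,5); (1,5); (5,6)] [:: (2,5); (3,5); (4,5); (0,6)].

Lemma forces_K2_P3_path : forces (K2_path ind_K2_P3) xpred0 [::].
Proof. by vm_compute. Qed.

Lemma forces_2K2_K1_path : forces (K2_path ind_2K2_K1) xpred0 [:: ind_K2_P3].
Proof. by vm_compute. Qed.

(** This rules out new middle vertices of 2-walks between {1, 2} and {3, 4}, and so yields distances
    of at least 3. *)
Lemma forces_linked_2K3_vertex :
  forces (extension 7 [::] [::] linked_2K3)
    (fun r => ~~ ((r 1 6 || r 2 6) && (r 3 6 || r 4 6))) [::].
Proof. by vm_compute. Qed.

Lemma forces_2K3_vertex :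
  forces (extension 7 [::] [::] ind_2K3)
    (fun r => [seq i <- iota 0 6 | r i 6] \in nbr_types)
    [:: ind_2K2_K1; ind_K2_P3; linked_2K3].
Proof. by vm_compute. Qed.

(** Adjacency of two further vertices amounts to their neighbourhoods in the triangles meeting. *)
Lemma forces_2K3_vertices :
  all (fun t => all (fun u => forces (ind_2K3_ext t u)
    (fun r => r 6 7 == has (mem u) t) [:: ind_K2_P3; linked_2K3])
    nbr_types) nbr_types.
Proof. by vm_compute. Qed.

(** * Correctness of the enumeration *)

Lemma mem_combinations m l c :
  c \in combinations m l -> [/\ size c = m, subseq c l & uniq l -> uniq c].
Proof.
move=> H; suff [sc sub]: size c = m /\ subseq c l.
  by split=> // ul; apply: subseq_uniq sub ul.
elim: l m c H => [|x l IH] [|m] c //=.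
- by rewrite inE => /eqP ->.
- by rewrite inE => /eqP ->.
rewrite mem_cat => /orP [/mapP [c' /IH [<- sub] ->] | /IH [<- sub]] /=.
  by rewrite eqxx.
split=> //; exact: (subseq_trans sub (subseq_cons l x)).
Qed.

Lemma mem_arrangements m l c : uniq l ->
  c \in arrangements m l -> [/\ size c = m, uniq c & {subset c <= l}].
Proof.
elim: m l c => [|m IH] l c ul /=; first by rewrite inE => /eqP ->.
case/allpairsPdep=> x [t [xl tl ->]] /=.
have [<- ut sub] := IH _ _ (rem_uniq x ul) tl.
split=> //=.
  by rewrite ut andbT; apply/negP => /sub; rewrite mem_rem_uniqF.
move=> y; rewrite inE => /orP [/eqP -> //|/sub]; exact: mem_rem.
Qed.

Lemma mem_row_fillings t (b : seq bool) : size b = size t ->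
  (forall i c, nth None t i = Some c -> nth false b i = c) ->
  b \in row_fillings t.
Proof.
elim: t b => [|o t IH] [|x b] //= [sb] H.
have Hb : b \in row_fillings t by apply: IH => // i c Hi; apply: (H i.+1).
case: o H => [c|] H.
  by rewrite -(H 0 c erefl) /=; apply: map_f.
by rewrite mem_cat; case: x {H}; apply/orP; [left | right]; apply: map_f.
Qed.

Section Code.
Variables (X : eqType) (r : rel X) (x0 : X).
Hypotheses (rsym : symmetric r) (rirr : irreflexive r).

Lemma adj_code s i j : i < size s -> j < size s ->
  adj (code r s) i j = r (nth x0 s i) (nth x0 s j).
Proof.
elim: s i j => // x s IH [|i] [|j] //= Hi Hj.
- by rewrite (nth_map x0).
- by rewrite (nth_map x0) // rsym.
- exact: IH.
Qed.

(** The offset [m] counts the rows already consumed, which lets the induction on [s] go through. *)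
Lemma code_fillings (c : nat -> nat -> option bool) m s :
  (forall i j b, i < size s -> j < size s -> c (m + i) (m + j) = Some b ->
     r (nth x0 s i) (nth x0 s j) = b) ->
  code r s \in fillings (template c m (size s)).
Proof.
elim: s m => [|x s IH] m H //=.
apply/allpairsPdep; exists (map (r x) s), (code r s); split=> //.
  apply: mem_row_fillings; first by rewrite !size_map size_iota.
  move=> i b; case: (ltnP i (size s)) => Hi; last first.
    by rewrite nth_default ?size_map ?size_iota.
  rewrite (nth_map 0) ?size_iota // nth_iota // (nth_map x0) // => E.
  by apply: (H 0 i.+1); rewrite //= addn0 addnS -addSn.
by apply: IH => i j b Hi Hj; rewrite !addSnnS; apply: (H i.+1 j.+1).
Qed.

Lemma matches_code h s : matches r x0 h s -> size s = order h ->
  code r s \in fillings (template (cell h) 0 (order h)).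
Proof.
move=> M <-; apply: code_fillings => i j b _ _; rewrite !add0n /cell.
move: M; rewrite /matches !everyE; case: ifP => // /allP HE /allP HN.
case: ifP => [/HE /= -> [] // | _]; case: ifP => // /HN /= /negbTE -> [] //.
Qed.

Lemma matches_map h s l : (forall p, p \in edges h ++ nonedges h -> p.1 < size l /\ p.2 < size l) ->
  {subset l <= iota 0 (size s)} ->
  matches (adj (code r s)) 0 h l -> matches r x0 h (map (nth x0 s) l).
Proof.
move=> Hh sub; rewrite /matches !everyE.
have E p : p \in edges h ++ nonedges h ->
    adj (code r s) (nth 0 l p.1) (nth 0 l p.2) =
    r (nth x0 (map (nth x0 s) l) p.1) (nth x0 (map (nth x0 s) l) p.2).
  move=> /Hh [H1 H2]; rewrite !(nth_map 0) //.
  have B q : q < size l -> nth 0 l q < size s.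
    by move=> /(mem_nth 0) /sub; rewrite mem_iota.
  by apply: adj_code; apply: B.
case: ifP => // /allP HE /allP HN; rewrite ifT; apply/allP => p Hp.
  by rewrite -E ?HN // mem_cat Hp orbT.
by rewrite -E ?HE // mem_cat Hp.
Qed.

End Code.

(** * Local resolving sets *)

Definition in_range h :=
  all (fun p => (p.1 < order h) && (p.2 < order h)) (edges h ++ nonedges h).

Lemma in_range_core_patterns : all in_range core_patterns.
Proof. by []. Qed.

Section Dimension.
Variables (T : finType) (e : rel T).

Lemma local_resolvingCP (S : {set T}) :
  reflect (forall u v, u \in S -> v \in S -> e u v ->
             exists2 w, w \notin S & dist e u w != dist e v w)
          (local_resolving e (~: S)).
Proof.
apply: (iffP forallP) => [H u v uS vS uv | H u].
  have /forallP/(_ v)/implyP := H u; rewrite !inE !negbK uS vS uv => /(_ isT).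
  by case/existsP => w /andP [wS d]; exists w => //; rewrite inE in wS.
apply/forallP => v; apply/implyP; rewrite !inE !negbK => /and3P [uS vS uv].
by have [w wS d] := H u v uS vS uv; apply/existsP; exists w; rewrite inE wS.
Qed.

Lemma local_metric_dim_le (W : {set T}) :
  local_resolving e W -> local_metric_dim e <= #|W|.
Proof.
rewrite /local_metric_dim => HW.
have : W \in index_enum {set T} by rewrite mem_index_enum.
elim: (index_enum _) => // A l IH; rewrite inE big_cons => /orP [/eqP <- | /IH le].
  by rewrite HW geq_minl.
by case: ifP => // _; rewrite (leq_trans _ le) ?geq_minr.
Qed.

Lemma local_metric_dim_ge k : k <= #|T| ->
  (forall W : {set T}, local_resolving e W -> k <= #|W|) ->
  k <= local_metric_dim e.
Proof.
move=> kT H; rewrite /local_metric_dim.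
by apply: (big_ind (leq k)) => // x y kx ky; rewrite leq_min kx ky.
Qed.

Lemma local_metric_dim_leC (S : {set T}) m :
  local_resolving e (~: S) -> m <= #|S| -> local_metric_dim e <= #|T| - m.
Proof.
move=> /local_metric_dim_le H mS; apply: (leq_trans H).
by rewrite cardsCs setCK leq_sub2l.
Qed.

(* Complements of local resolving sets are closed under subsets, so a bound on
   those of one given cardinality bounds them all. *)
Lemma local_metric_dim_geC m :
  (forall S : {set T}, #|S| = m.+1 -> ~~ local_resolving e (~: S)) ->
  #|T| - m <= local_metric_dim e.
Proof.
move=> H; apply: local_metric_dim_ge => [|W HW]; first exact: leq_subr.
rewrite leq_subLR -(cardsC W) addnC leq_add2r leqNgt; apply/negP.
case/card_geqP => s [us ss sub].
have /H /negP : #|[set x in s]| = m.+1 by rewrite cardsE (card_uniqP us).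
apply.
move: HW; rewrite -{1}[W]setCK => /local_resolvingCP HW.
apply/local_resolvingCP => u v; rewrite !inE => /sub us' /sub vs' uv.
have [w wW d] := HW u v us' vs' uv; exists w => //.
by rewrite inE; apply: contra wW => /sub.
Qed.

(** With three vertices the search range starts with 0, 1, 2. The value in the last branch matters
    only through being at least 3. *)
Lemma distE x y : 3 <= #|T| ->
  dist e x y = if x == y then 0 else if e x y then 1
    else if [exists z, e x z && e z y] then 2
    else (find (fun k => walkn e k x y) (iota 3 (#|T| - 3))).+3.
Proof.
rewrite /dist; case: #|T| => [|[|[|n]]] // _; rewrite !subSS subn0 /=.
have w1 u v : [exists z, e u z && (z == v)] = e u v.
  apply/existsP/idP => [[z /andP [uz /eqP <-]] // | uv].
  by exists v; rewrite uv eqxx.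
rewrite w1; under eq_existsb do rewrite w1.
by case: (x == y); case: (e x y); case: [exists z, e x z && e z y].
Qed.

Lemma dist_neq_adj u v w : irreflexive e -> 3 <= #|T| ->
  e u w != e v w -> u != w -> v != w -> dist e u w != dist e v w.
Proof.
move=> eirr n3 H uw vw; rewrite !distE // (negbTE uw) (negbTE vw).
by case: (e u w) (e v w) H => [] [] //= _; case: ifP.
Qed.

(** The common neighbour [z] puts [u] at distance 2 from [w], while [v] has no common neighbour with
    [w] and gets a value of at least 3. *)
Lemma dist_neq_common u v w z : 3 <= #|T| ->
  u != w -> v != w -> ~~ e u w -> ~~ e v w -> e u z -> e z w ->
  (forall y, e v y -> ~~ e y w) -> dist e u w != dist e v w.
Proof.
move=> n3 uw vw euw evw uz zw H.
rewrite !distE // (negbTE uw) (negbTE vw) (negbTE euw) (negbTE evw).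
rewrite ifT; last by apply/existsP; exists z; rewrite uz.
by rewrite ifF //; apply/existsP => -[y /andP [/H /negbTE ->]].
Qed.

End Dimension.

(** * From patterns to graphs without good 4-sets *)

Section Patterns.
Variables (T : finType) (e : rel T).
Hypotheses (esym : symmetric e) (eirr : irreflexive e).
Hypothesis small : forall S : {set T}, local_resolving e (~: S) -> #|S| <= 3.
Variable x0 : T.

Definition contains h :=
  exists s, [/\ uniq s, size s = order h & matches e x0 h s].

(** A vertex adjacent to exactly one of [u], [v] distinguishes them in the whole graph, whatever
    lies outside [s]. So a separated 4-subset would be a good set of size 4. *)
Lemma unseparated_code s : 3 <= #|T| -> uniq s ->
  unseparated (adj (code e s)) (size s).
Proof.
move=> n3 us; rewrite /unseparated someE; apply/hasP => -[l].
case/mem_combinations => sl sub /(_ (iota_uniq _ _)) ul; rewrite /separated.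
have {}sub := mem_subseq sub; rewrite everyE => /allP Hl.
have ltl i : i \in l -> i < size s by move/sub; rewrite mem_iota.
pose nu := nth x0 s; pose S := [set x in map nu l].
have inS x : (x \in S) = (x \in map nu l) by rewrite inE.
have := @small S; rewrite (_ : #|S| = 4); last first.
  rewrite cardsE; have /card_uniqP -> : uniq (map nu l).
    rewrite map_inj_in_uniq // => i j /ltl li /ltl lj /eqP.
    by rewrite /nu nth_uniq // => /eqP.
  by rewrite size_map.
suff -> : local_resolving e (~: S) by move/(_ isT).
apply/local_resolvingCP => u v; rewrite !inS => /mapP [i il ->] /mapP [j jl ->].
move=> uv; have := Hl i il; rewrite everyE => /allP /(_ j jl).
rewrite !(adj_code x0) ?ltl // uv someE => /hasP [k].
rewrite mem_iota add0n /= => ks; rewrite !(adj_code x0) ?ks ?(ltl _ il) ?(ltl _ jl) //.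
case: ifP => // /negbT ne kl; exists (nu k).
  rewrite inS; apply/negP => /mapP [m ml /eqP].
  by rewrite nth_uniq ?ks ?(ltl _ ml) // => /eqP km; rewrite km ml in kl.
have nk m : m \in l -> nu m != nu k.
  move=> ml; rewrite nth_uniq ?ks ?(ltl _ ml) //; apply/eqP => mk.
  by rewrite -mk ml in kl.
by apply: dist_neq_adj; rewrite ?nk.
Qed.

Lemma has_pattern_contains h s : in_range h -> uniq s ->
  has_pattern (adj (code e s)) (size s) h -> contains h.
Proof.
move=> /allP rh us; rewrite /has_pattern someE => /hasP [l].
case/(mem_arrangements (iota_uniq _ _)) => sl ul sub M.
exists (map (nth x0 s) l); split.
- rewrite map_inj_in_uniq // => i j /sub + /sub.
  by rewrite !mem_iota => /= li lj /eqP; rewrite nth_uniq // => /eqP.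
- by rewrite size_map.
by apply: matches_map M => // p /rh /andP []; rewrite sl.
Qed.

Definition contains_any := foldr (fun h Q => contains h \/ Q) False.

(** The bridge from computation to graphs: the code of [s] is one of the enumerated completions of
    [h], and it is unseparated. *)
Lemma forcesP h P hs s : forces h P hs -> all in_range hs -> 3 <= #|T| ->
  uniq s -> size s = order h -> matches e x0 h s ->
  P (adj (code e s)) \/ contains_any hs.
Proof.
rewrite /forces everyE => /allP F rhs n3 us ss M.
have := F _ (matches_code M ss); rewrite -ss unseparated_code //.
case: ifP => [|_]; first by left.
elim: hs rhs {F} => //= h' hs IH /andP [rh rhs].
case: ifP => [H _ | _ /(IH rhs) [] ]; [| by left | by right; right].
by right; left; apply: has_pattern_contains H.
Qed.


(** * Cores of the complement graph *)

Section Structure.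

Hypothesis hn : 5 <= #|T|.
Hypothesis hw : clique_number e <= #|T| - 3.

Definition coedge x y := (x != y) && ~~ e x y.

Lemma coedge_sym x y : coedge x y = coedge y x.
Proof. by rewrite /coedge eq_sym esym. Qed.

(** The at least [#|T| - 2] vertices other than [x] and [y] are too many to form a clique; in the
    complement, [x] and [y] do not cover all edges. *)
Lemma coedge_avoiding x y : exists u v,
  [/\ coedge u v, u \notin [:: x; y] & v \notin [:: x; y]].
Proof.
pose A := ~: [set x; y].
have nA : ~~ clique e A.
  apply/negP => cA.
  have le : #|A| <= clique_number e.
    exact: (leq_bigmax_cond (F := fun B : {set T} => #|B|)).
  have n3 : 3 <= #|T| by apply: leq_trans hn.
  move: (leq_trans le hw); rewrite leq_subRL // -[#|T|](cardsC [set x; y]).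
  by rewrite cards2 leq_add2r; case: (x != y).
move: nA; rewrite negb_forall => /existsP [u]; rewrite negb_imply.
case/andP => uA; rewrite negb_forall => /existsP [v].
rewrite !negb_imply => /andP [vA uv].
by exists u, v; split=> //; [move: uA | move: vA]; rewrite !inE.
Qed.

Definition contains_core :=
  contains_any [:: co_K4; co_3K2; co_K3_K2; co_C5].

Lemma co_K4_core a b c d : uniq [:: a; b; c; d] ->
  coedge a b -> coedge a c -> coedge a d -> coedge b c -> coedge b d ->
  coedge c d -> contains_core.
Proof.
move=> u /andP [_ H1] /andP [_ H2] /andP [_ H3] /andP [_ H4] /andP [_ H5].
move=> /andP [_ H6]; left; exists [:: a; b; c; d]; split=> //.
by rewrite /matches /= H1 H2 H3 H4 H5 H6.
Qed.

Lemma co_3K2_core a b c d f g : uniq [:: a; b; c; d; f; g] ->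
  coedge a b -> coedge c d -> coedge f g -> contains_core.
Proof.
move=> u /andP [_ H1] /andP [_ H2] /andP [_ H3].
right; left; exists [:: a; b; c; d; f; g]; split=> //.
by rewrite /matches /= H1 H2 H3.
Qed.

Lemma co_K3_K2_core a b c d f : uniq [:: a; b; c; d; f] ->
  coedge a b -> coedge a c -> coedge b c -> coedge d f -> contains_core.
Proof.
move=> u /andP [_ H1] /andP [_ H2] /andP [_ H3] /andP [_ H4].
right; right; left; exists [:: a; b; c; d; f]; split=> //.
by rewrite /matches /= H1 H2 H3 H4.
Qed.

Lemma co_C5_core a b c d f : uniq [:: a; b; c; d; f] ->
  coedge a b -> coedge b c -> coedge c d -> coedge d f -> coedge f a ->
  contains_core.
Proof.
move=> u /andP [_ H1] /andP [_ H2] /andP [_ H3] /andP [_ H4] /andP [_ H5].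
right; right; right; left; exists [:: a; b; c; d; f]; split=> //.
by rewrite /matches /= H1 H2 H3 H4 esym H5.
Qed.

Lemma uniq_rcons2 (s : seq T) x y : uniq s -> x \notin s -> y \notin s -> x != y ->
  uniq (x :: y :: s).
Proof. by move=> us xs ys xy; rewrite /= inE negb_or xy xs ys us. Qed.

Ltac distinct :=
  rewrite /= ?inE ?negb_or;
  repeat match goal with
  | H : is_true (_ \notin _) |- _ => rewrite !inE ?negb_or in H
  | H : is_true (uniq _) |- _ => rewrite /= ?inE ?negb_or in H
  | H : is_true (coedge _ _) |- _ => case/andP: H => ? ?
  | H : is_true (_ && _) |- _ => case/andP: H => ? ?
  end;
  repeat (apply/andP; split); by [| rewrite eq_sym].

Ltac same_mem := move=> ?; rewrite !inE;
  repeat match goal with |- context [?u == ?t] => case: (u == t) end; by [].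

(** Only [p] and [r] may have coedges leaving the four vertices; each pair among the four fails to
    be a vertex cover of the complement, and the uncovered coedges assemble into a core. *)
Lemma core_of_matching p q r s : uniq [:: p; q; r; s] ->
  coedge p q -> coedge r s ->
  (forall x, x \notin [:: p; q; r; s] -> ~~ coedge q x /\ ~~ coedge s x) ->
  contains_core.
Proof.
move=> u pq rs out.
(* A coedge disjoint from the four vertices completes the matching to a 3K2; afterwards there is
   none. *)
have [[x [y [xQ yQ xy]]]|noxy] : (exists x y,
    [/\ x \notin [:: p; q; r; s], y \notin [:: p; q; r; s] & coedge x y]) \/
    (forall x y, x \notin [:: p; q; r; s] -> y \notin [:: p; q; r; s] -> ~~ coedge x y).
  case: (pickP (fun z => [&& z.1 \notin [:: p; q; r; s],
     z.2 \notin [:: p; q; r; s] & coedge z.1 z.2])) => [[x y] /= /and3P [? ? ?]|H].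
    by left; exists x, y.
  by right=> x y xQ yQ; have := H (x, y); rewrite /= xQ yQ /= => ->.
- have xny : x != y by case/andP: xy.
  by apply: (@co_3K2_core x y p q r s) => //; apply: uniq_rcons2.
(* A coedge avoiding [a] and [b] has an end among [c], [d], so it is [c d] or leaves the four
   vertices from one of them. *)
have find a b c d : [:: a; b; c; d] =i [:: p; q; r; s] ->
    [\/ coedge c d, exists2 x, x \notin [:: p; q; r; s] & coedge c x
      | exists2 x, x \notin [:: p; q; r; s] & coedge d x].
  move=> pm; have [x [y [xy xab yab]]] := coedge_avoiding a b.
  have mQ z : z \notin [:: a; b] -> [\/ z = c, z = d | z \notin [:: p; q; r; s]].
    rewrite -pm !inE !negb_or => /andP [-> ->] /=.
    case: eqVneq => [->|_] /=; first by constructor.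
    by case: eqVneq => [->|_] /=; constructor.
  case: (mQ x xab) (mQ y yab) xy => [->|->|xQ] [->|->|yQ] xy.
  - by rewrite /coedge eqxx in xy.
  - by constructor 1.
  - by constructor 2; exists y.
  - by constructor 1; rewrite coedge_sym.
  - by rewrite /coedge eqxx in xy.
  - by constructor 3; exists y.
  - by constructor 2; exists x; rewrite // coedge_sym.
  - by constructor 3; exists x; rewrite // coedge_sym.
  - by have := noxy _ _ xQ yQ; rewrite xy.
have qx x : x \notin [:: p; q; r; s] -> coedge q x -> False.
  by move=> /out [/negP].
have sx x : x \notin [:: p; q; r; s] -> coedge s x -> False.
  by move=> /out [_ /negP].
have qs : coedge q s.
  by case: (find p r q s) => [|//|[x /qx]|[x /sx]] //; same_mem.
have qr_or : coedge q r \/ exists2 x, x \notin [:: p; q; r; s] & coedge r x.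
  case: (find p s q r); [by same_mem | by left | by case=> x /qx | by right].
have ps_or : coedge p s \/ exists2 x, x \notin [:: p; q; r; s] & coedge p x.
  case: (find q r p s); [by same_mem | by left | by right | by case=> x /sx].
have pr_or : [\/ coedge p r, exists2 x, x \notin [:: p; q; r; s] & coedge p x
    | exists2 x, x \notin [:: p; q; r; s] & coedge r x].
  by case: (find q s p r); [same_mem | constructor 1 | constructor 2 | constructor 3].
have [sp sr] : coedge s p = coedge p s /\ coedge s r = coedge r s.
  by split; apply: coedge_sym.
have cross x : x \notin [:: p; q; r; s] -> coedge p x -> coedge q r -> contains_core.
  move=> xQ px qr; apply: (@co_K3_K2_core q r s p x) => //; distinct.
have cross' x : x \notin [:: p; q; r; s] -> coedge r x -> coedge p s -> contains_core.
  move=> xQ rx ps; apply: (@co_K3_K2_core p q s r x) => //; distinct.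
case: qr_or ps_or => [qr|[x xQ rx]] [ps|[y yQ py]].
- case: pr_or => [pr|[x xQ px]|[x xQ rx]].
  + exact: (@co_K4_core p q r s).
  + exact: cross xQ px qr.
  + exact: cross' xQ rx ps.
- exact: cross yQ py qr.
- exact: cross' xQ rx ps.
(* Both [r] and [p] have outer coedges: a common outer end closes the 5-cycle p q s r x, distinct
   ones give the 3K2 of [r x], [p y], [q s]. *)
- case: (eqVneq x y) py yQ => [<-|xy] py yQ.
    apply: (@co_C5_core p q s r x) => //; rewrite ?sr // 1?coedge_sym //; distinct.
  apply: (@co_3K2_core r x p y q s) => //; distinct.
Qed.

(** Start from two disjoint coedges. Either one of them has coedges leaving the four vertices at
    both ends ([both]), or each has an end without any, and these ends play [q] and [s] in
    [core_of_matching]. *)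
Lemma core_exists : contains_core.
Proof.
have [p [q [pq _ _]]] := coedge_avoiding x0 x0.
have [r [s [rs rQ sQ]]] := coedge_avoiding p q.
have u : uniq [:: p; q; r; s] by move: rQ sQ => rQ sQ; distinct.
pose touched z := [exists x, (x \notin [:: p; q; r; s]) && coedge z x].
(* The outer coedges at [a] and [b] form a triangle with [a b] if they share their outer end, next
   to the disjoint [c d]; otherwise they form a 3K2 with [c d]. *)
have both a b c d : [:: a; b; c; d] =i [:: p; q; r; s] -> uniq [:: a; b; c; d] ->
    coedge a b -> coedge c d -> touched a -> touched b -> contains_core.
  move=> pm u' ab cd /existsP [x /andP [xQ ax]] /existsP [y /andP [yQ bYy]].
  rewrite -!pm in xQ yQ; case: (eqVneq x y) bYy yQ => [<-|xy] bx yQ.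
    apply: (@co_K3_K2_core a b x c d) => //; distinct.
  apply: (@co_3K2_core a x b y c d) => //; distinct.
have matching a b c d : [:: a; b; c; d] =i [:: p; q; r; s] ->
    coedge a b -> coedge c d -> ~~ touched b -> ~~ touched d -> contains_core.
  move=> pm ab cd /existsPn nb /existsPn nd.
  apply: (@core_of_matching a b c d) => //.
    by apply: etrans u; apply: eq_uniq.
  by move=> x; rewrite pm => xQ; have := nb x; have := nd x; rewrite xQ.
have qp : coedge q p by rewrite coedge_sym.
have sr : coedge s r by rewrite coedge_sym.
case tq: (touched q); last first.
  case ts: (touched s); last by apply: (@matching p q r s) => //; rewrite ?tq ?ts.
  case tr: (touched r); last first.
    by apply: (@matching p q s r) => //; rewrite ?tq ?tr //; same_mem.
  by apply: (@both r s p q) => //; [same_mem | distinct].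
case tp: (touched p); first by apply: (@both p q r s).
case ts: (touched s); last first.
  by apply: (@matching q p r s) => //; rewrite ?tp ?ts //; same_mem.
case tr: (touched r); last first.
  by apply: (@matching q p s r) => //; rewrite ?tp ?tr //; same_mem.
by apply: (@both r s p q) => //; [same_mem | distinct].
Qed.


(** * Excluding patterns by connectedness and distances *)

Hypothesis hconn : connected_graph e.

Let n3 : 3 <= #|T|. Proof. by apply: leq_trans hn. Qed.

Lemma matchesE h s : matches e x0 h s =
  all (fun p => e (nth x0 s p.1) (nth x0 s p.2)) (edges h) &&
  all (fun p => ~~ e (nth x0 s p.1) (nth x0 s p.2)) (nonedges h).
Proof. by rewrite /matches !everyE. Qed.

Ltac unfold_matches H :=
  move: H; rewrite matchesE /= ?andbT => H;
  repeat match goal with H : is_true (_ && _) |- _ => case/andP: H => ? ? end.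

Ltac prove_matches := rewrite matchesE /=; repeat (apply/andP; split); by [].

Lemma forces_contains h hs : forces h xpred0 hs -> all in_range hs ->
  contains h -> contains_any hs.
Proof. by move=> F rhs [s [us ss M]]; case: (forcesP F rhs n3 us ss M). Qed.

Lemma contains_core_patterns : contains_any core_patterns.
Proof.
have r := in_range_core_patterns.
case: core_exists => [H|[H|[H|[H|//]]]].
- by case: (forces_contains forces_co_K4 isT H).
- exact: (forces_contains forces_co_3K2 r H).
- exact: (forces_contains forces_co_K3_K2 r H).
- exact: (forces_contains forces_co_C5 r H).
Qed.

(** The form in which connectedness is used: without such an edge [A] would be a union of
    components. *)
Lemma closed_neq (A : pred T) x y : x \in A -> y \notin A ->
  exists u v, [/\ u \in A, v \notin A & e u v].
Proof.
move=> xA yA; case: (pickP (fun p => [&& p.1 \in A, p.2 \notin A & e p.1 p.2])).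
  by move=> [u v] /= /and3P [? ? ?]; exists u, v.
move=> H; have cA : closed e A.
  apply: (intro_closed (sym_connect_sym esym)) => u v uv uA.
  by apply/negPn/negP => vA; have := H (u, v); rewrite /= uA vA uv.
by rewrite -(closed_connect cA (hconn x y)) xA in yA.
Qed.

(** An edge [u v] must leave the closed neighbourhood of [a]. If [u] is [b], then [v] sees just one
    end of the K2, against [nbr]; otherwise [u] is a new vertex attached to the K2, and [v]
    continues the path that [path] forbids. *)
Lemma K2_component a b c d f : uniq [:: a; b; c; d; f] -> e a b ->
  [&& ~~ e a c, ~~ e a d, ~~ e a f, ~~ e b c, ~~ e b d & ~~ e b f] ->
  (forall w, w \notin [:: a; b; c; d; f] -> K2_nbr (adj (code e [:: a; b; c; d; f; w]))) ->
  (forall v w, uniq [:: a; b; c; d; f; v; w] -> e a v -> e b v -> e v w ->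
     ~~ e a w -> [&& ~~ e c v, ~~ e d v & ~~ e f v] -> False) -> False.
Proof.
move=> us ab /and5P [ac ad af bc /andP [bd bf]] nbr path.
pose A : pred T := fun v => (v == a) || e a v.
have mA v : (v \in A) = (v == a) || e a v by [].
have Ac : c \notin A.
  by rewrite mA negb_or ac andbT; apply: contraTneq us => ->; rewrite /= !inE eqxx !orbT.
have [|u [v [uA vA uv]]] := closed_neq _ Ac (x := a); first by rewrite mA eqxx.
move: uA vA; rewrite !mA negb_or => uA => /andP [va av].
case/orP: uA => [/eqP ua|au]; first by rewrite -ua uv in av.
have vb : v != b by apply: contraNneq av => ->.
have ub : u \notin [:: a; c; d; f].
  apply/negP; rewrite !inE => /or4P [] /eqP E; subst u.
  - by rewrite eirr in au.
  - by rewrite au in ac.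
  - by rewrite au in ad.
  - by rewrite au in af.
case: (eqVneq u b) ub => [E _|nub ub]; first subst u.
  have vs : v \notin [:: a; b; c; d; f].
    rewrite !inE (negbTE va) (negbTE vb) /=; apply/negP => /or3P [] /eqP E; subst v.
    - by rewrite uv in bc.
    - by rewrite uv in bd.
    - by rewrite uv in bf.
  by have := nbr v vs; rewrite /K2_nbr /= (negbTE av) uv.
have us' : u \notin [:: a; b; c; d; f].
  by move: ub; rewrite !inE (negbTE nub) !negb_or.
have := nbr u us'; rewrite /K2_nbr /= au => /andP [/eqP bu /and3P [cu du fu]].
have vs : v \notin [:: a; b; c; d; f].
  rewrite !inE (negbTE va) (negbTE vb) /=; apply/negP => /or3P [] /eqP E; subst v.
  - by rewrite esym uv in cu.
  - by rewrite esym uv in du.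
  - by rewrite esym uv in fu.
apply: (path u v) => //; last by rewrite cu du fu.
have uv' : u != v by apply: contraTneq uv => ->; rewrite eirr.
rewrite -[X in uniq X]/([:: a; b; c; d; f] ++ [:: u; v]) cat_uniq us /=.
by rewrite (negbTE us') (negbTE vs) /= inE uv'.
Qed.

Lemma not_ind_K2_P3 : ~ contains ind_K2_P3.
Proof.
move=> [s [us ss M]]; case: s us ss M => [|a [|b [|c [|d [|f [|? ?]]]]]] // us _ M; unfold_matches M.
apply: (@K2_component a b c d f) => // [|w ws|v w u av bv vw aw].
- by do !(apply/andP; split).
- have [] // := forcesP forces_K2_P3_vertex isT n3 (s := [:: a; b; c; d; f; w]).
    by rewrite -[X in uniq X]/([:: a; b; c; d; f] ++ [:: w]) cat_uniq us /= orbF ws.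
  prove_matches.
- case/and3P=> cv dv fv.
  have [] // := forcesP forces_K2_P3_path isT n3 (s := [:: a; b; c; d; f; v; w]) u.
  prove_matches.
Qed.

Lemma not_ind_2K2_K1 : ~ contains ind_2K2_K1.
Proof.
move=> [s [us ss M]]; case: s us ss M => [|a [|b [|c [|d [|f [|? ?]]]]]] // us _ M; unfold_matches M.
apply: (@K2_component a b c d f) => // [|w ws|v w u av bv vw aw].
- by do !(apply/andP; split).
- have [] // := forcesP forces_2K2_K1_vertex isT n3 (s := [:: a; b; c; d; f; w]).
  + by rewrite -[X in uniq X]/([:: a; b; c; d; f] ++ [:: w]) cat_uniq us /= orbF ws.
  + prove_matches.
  + by case=> // /not_ind_K2_P3.
- case/and3P=> cv dv fv.
  have [] // := forcesP forces_2K2_K1_path isT n3 (s := [:: a; b; c; d; f; v; w]) u.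
    prove_matches.
  by case=> // /not_ind_K2_P3.
Qed.

(** The good 4-set is [a1], [a2], [x], [b1], which induces the path a2 a1 x b1. Its three edges are
    separated by [b2], [b2] and [a3]. *)
Lemma not_linked_2K3 : ~ contains linked_2K3.
Proof.
move=> [s [us ss M]]; case: s us ss M => [|a1 [|a2 [|a3 [|b1 [|b2 [|x [|? ?]]]]]]] // us _ M; unfold_matches M.
pose s := [:: a1; a2; a3; b1; b2; x].
have cross y : y \notin s -> ~~ ((e a2 y || e a3 y) && (e b1 y || e b2 y)).
  move=> ys; have [] // := forcesP forces_linked_2K3_vertex isT n3 (s := s ++ [:: y]).
    by rewrite cat_uniq us /= orbF ys.
  rewrite /s; prove_matches.
have split_s (P : T -> Prop) : P a1 -> P a2 -> P a3 -> P b1 -> P b2 -> P x ->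
    (forall y, y \notin s -> P y) -> forall y, P y.
  move=> ? ? ? ? ? ? H y; have [|/H //] := boolP (y \in s).
  by rewrite !inE => /or4P [/eqP->|/eqP->|/eqP->|/or3P [] /eqP->].
have nsep : forall y, e a2 y -> ~~ e y b2.
  apply: split_s; try first [by [] | by rewrite eirr | by apply: contraTN].
  by move=> y /cross + a2y; rewrite a2y /= negb_or !(esym y) => /andP [].
(* The exception is genuine: [x] sees [b1], and its adjacency to [a3] is left open by the
   pattern. *)
have nsep' : forall y, e y b1 -> ~~ e a3 y || (y == x).
  apply: split_s; rewrite ?eqxx ?orbT;
    try first [by [] | by rewrite eirr | by apply: contraTT | by move=> _; apply/orP; left].
  by move=> y /cross + yb; rewrite (esym b1) yb /= andbT negb_or => /andP [_ ->].
have D := us; rewrite /= !inE !negb_or in D.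
repeat match goal with H : is_true (_ && _) |- _ => case/andP: H => ? ? end.
have [a1b2 xb2] : e a1 b2 = false /\ e x b2 by rewrite esym (esym x); split=> //; apply/negbTE; rewrite esym.
have d1 : dist e a1 b2 != dist e a2 b2.
  by apply: (dist_neq_common (z := x)); rewrite ?a1b2.
have d2 : dist e a1 b2 != dist e x b2.
  by apply: dist_neq_adj; rewrite ?a1b2 ?xb2 // eq_sym.
have a3b1 : e b1 a3 = false by rewrite esym; apply/negbTE.
(* If [x] misses [a3], it still reaches it in two steps through [a1], whereas the exception in
   [nsep'] disappears and [b1] has no common neighbour with [a3]. *)
have d3 : dist e x a3 != dist e b1 a3.
  case xa3: (e x a3).
    by apply: dist_neq_adj; rewrite ?xa3 ?a3b1 // eq_sym.
  apply: (dist_neq_common (z := a1)); rewrite ?xa3 ?a3b1 // 1?eq_sym 1?esym //.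
  move=> y; rewrite esym => /nsep' /orP [|/eqP ->]; first by rewrite esym.
  by rewrite xa3.
pose S := [set a1; a2; x; b1].
have := @small S; suff [-> ->] : local_resolving e (~: S) /\ #|S| = 4 by move/(_ isT).
have inS y : (y \in S) = (y \in [:: a1; a2; x; b1]) by rewrite !inE -!orbA.
split; last first.
  rewrite (eq_card inS); apply/card_uniqP.
  by rewrite /= !inE !negb_or !andbT; do !(apply/andP; split) => //; rewrite eq_sym.
have b2S : b2 \notin S.
  by rewrite inS !inE !negb_or; do !(apply/andP; split) => //; rewrite eq_sym.
have a3S : a3 \notin S.
  by rewrite inS !inE !negb_or; do !(apply/andP; split) => //; rewrite eq_sym.
have N y z : ~~ e y z -> e y z -> exists2 w, w \notin S & dist e y w != dist e z w.
  by move=> /negPf ->.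
apply/local_resolvingCP => u v; rewrite !inS !inE.
by case/or4P=> /eqP-> /or4P[] /eqP->;
  first [by rewrite eirr | by apply: N | by apply: N; rewrite esym | move=> _];
  first [by exists b2; rewrite // eq_sym | by exists a3; rewrite // eq_sym].
Qed.


(** * Structure of the graphs without good 4-sets *)

Lemma isomorphic_C5 : contains ind_C5 -> isomorphic e C5.
Proof.
move=> [s [us ss M]].
have sT y : y \in s.
  apply/negPn/negP => ys.
  have [] // := forcesP forces_C5_vertex isT n3 (s := rcons s y).
  - by rewrite rcons_uniq ys.
  - by rewrite size_rcons ss.
  - by case: s ss M {us ys} => [|a [|b [|c [|d [|f [|? ?]]]]]].
have idx y : index y s < 5 by rewrite -[5]ss index_mem.
pose f y := Ordinal (idx y).
have eC (i j : 'I_5) : C5 i j = e (nth x0 s i) (nth x0 s j).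
  case: s ss M {us sT idx f} => [|a [|b [|c [|d [|g [|? ?]]]]]] // _ M.
  unfold_matches M.
  by case: i j => [[|[|[|[|[|i]]]]] ?] [[|[|[|[|[|j]]]]] ?] //;
    rewrite /= /C5 /=; symmetry; rewrite ?eirr //; first
    [done | by apply/negbTE | by rewrite esym | by rewrite esym; apply/negbTE].
exists f; split; last by move=> x y; rewrite eC !nth_index.
exists (fun i : 'I_5 => nth x0 s i) => [y|i]; first by rewrite /= nth_index.
by apply/val_inj; rewrite /= index_uniq // ss.
Qed.

(** For disjoint [A] and [B] these are two cliques without edges between them, plus vertices
    adjacent to everything. *)
Definition clique_join (A B : {set T}) :=
  forall u v, e u v = (u != v) && ~~ ((u \in A) && (v \in B) || (u \in B) && (v \in A)).

(** Listing [A], then [B], then the rest makes the index of a vertex fall into the range that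
    [Kminus] assigns to its part. *)
Lemma isomorphic_Kminus (A B : {set T}) : [disjoint A & B] -> clique_join A B ->
  isomorphic e (Kminus #|T| #|A| #|B|).
Proof.
move=> dAB AB; pose s := enum A ++ enum B ++ enum (~: (A :|: B)).
have ms x : x \in s.
  by rewrite !mem_cat !mem_enum !inE; case: (x \in A); case: (x \in B).
have us : uniq s.
  rewrite !cat_uniq !enum_uniq /= andbT; apply/andP; split.
    apply/hasPn => x; rewrite mem_cat !mem_enum !inE => /orP [xB|].
      by apply/negP => xA; rewrite (disjointFr dAB xA) in xB.
    by rewrite negb_or => /andP [].
  apply/hasPn => x; rewrite !mem_enum !inE negb_or => /andP [] //.
have ss : size s = #|T| by rewrite -(card_uniqP us); apply: eq_card.
have idx x : index x s < #|T| by rewrite -ss index_mem.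
have iA x : (index x s < #|A|) = (x \in A).
  rewrite /s index_cat mem_enum cardE.
  case: ifP => xA; first by rewrite index_mem mem_enum.
  by rewrite ltnNge leq_addr.
have iB x : (#|A| <= index x s) && (index x s < #|A| + #|B|) = (x \in B).
  rewrite leqNgt iA; case xA: (x \in A); first by rewrite (disjointFr dAB xA).
  rewrite /s !index_cat !mem_enum xA /= cardE ltn_add2l cardE.
  case: ifP => xB; first by rewrite index_mem mem_enum.
  by rewrite ltnNge leq_addr.
exists (fun x => Ordinal (idx x)); split; last first.
  move=> x y; rewrite /Kminus /= !iA !iB AB -val_eqE /=; congr (~~ _ && _).
  apply/eqP/eqP => [E|-> //]; rewrite -(nth_index x0 (ms x)) E nth_index //.
apply: inj_card_bij; last by rewrite card_ord.
by move=> x y [E]; rewrite -(nth_index x0 (ms x)) E nth_index.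
Qed.

Lemma matches_extension k E N h s : matches e x0 (extension k E N h) s =
  [&& matches e x0 h s,
      all (fun p => e (nth x0 s p.1) (nth x0 s p.2)) E &
      all (fun p => ~~ e (nth x0 s p.1) (nth x0 s p.2)) N].
Proof. by rewrite !matchesE /= !all_cat -!andbA; do !bool_congr. Qed.

(** Every vertex gets one of three types, and distinct vertices are adjacent exactly when their
    types meet. The two disjoint types give [A] and [B]; the full type is adjacent to everything. *)
Lemma clique_join_of_2K3 : contains ind_2K3 -> exists A B : {set T},
  [/\ [disjoint A & B], clique_join A B, 3 <= #|A| & 3 <= #|B|].
Proof.
move=> [s [us ss M]].
pose N y := [seq i <- iota 0 6 | e (nth x0 s i) y].
have Ntype y : y \notin s -> N y \in nbr_types.
  move=> ys; have [] // := forcesP forces_2K3_vertex isT n3 (s := s ++ [:: y]).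
  - by rewrite cat_uniq us /= orbF ys.
  - by rewrite size_cat ss.
  - by case: s ss M {us ys N} => [|a1 [|a2 [|a3 [|b1 [|b2 [|b3 [|? ?]]]]]]].
  - by rewrite /N; case: s ss {us M ys N} => [|a1 [|a2 [|a3 [|b1 [|b2 [|b3 [|? ?]]]]]]].
  - by case=> [/not_ind_2K2_K1|[/not_ind_K2_P3|[/not_linked_2K3|]]].
have Nadj y z : y \notin s -> z \notin s -> y != z ->
    e y z = has (mem (N z)) (N y).
  move=> ys zs yz.
  have F : forces (ind_2K3_ext (N y) (N z)) (fun r => r 6 7 == has (mem (N z)) (N y))
      [:: ind_K2_P3; linked_2K3].
    have /allP/(_ _ (Ntype y ys))/allP/(_ _ (Ntype z zs)) := forces_2K3_vertices.
    exact.
  have mN w i : (i \in N w) = (i < 6) && e (nth x0 s i) w.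
    by rewrite mem_filter mem_iota /= andbC.
  have [] // := forcesP F isT n3 (s := s ++ [:: y; z]).
  - by rewrite cat_uniq us /= orbF negb_or ys zs inE yz.
  - by rewrite size_cat ss.
  - have n6 : nth x0 (s ++ [:: y; z]) 6 = y by rewrite nth_cat ss.
    have n7 : nth x0 (s ++ [:: y; z]) 7 = z by rewrite nth_cat ss.
    have nlt i : i < 6 -> nth x0 (s ++ [:: y; z]) i = nth x0 s i.
      by move=> i6; rewrite nth_cat ss i6.
    rewrite matches_extension; apply/and3P; split.
    + by case: s ss M {us ys zs N Ntype F mN n6 n7 nlt} => [|a1 [|a2 [|a3 [|b1 [|b2 [|b3 [|? ?]]]]]]].
    + rewrite all_cat !all_map; apply/andP; split; apply/allP => i.
        by rewrite mN => /andP [i6 iy] /=; rewrite n6 nlt.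
      by rewrite mN => /andP [i6 iz] /=; rewrite n7 nlt.
    + rewrite all_cat !all_map; apply/andP; split; apply/allP => i.
        rewrite mem_filter mem_iota mN add0n => /and3P [+ _ i6] /=.
        by rewrite n6 nlt // i6.
      rewrite mem_filter mem_iota mN add0n => /and3P [+ _ i6] /=.
      by rewrite n7 nlt // i6.
  - rewrite (_ : adj _ 6 7 = e y z); first by move/eqP.
    by rewrite (adj_code x0) ?size_cat ?ss //= !nth_cat ss.
  - by case=> [/not_ind_K2_P3|[/not_linked_2K3|]].
(* A triangle vertex, which does not see itself, gets its whole triangle as type. Outside [s] the
   index is 6, so [N y] is taken. *)
pose tau y := if index y s < 3 then [:: 0; 1; 2]
  else if index y s < 6 then [:: 3; 4; 5] else N y.
have tauN y : y \notin s -> tau y = N y.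
  by move=> ys; rewrite /tau memNindex // ss.
have tau_type y : tau y \in nbr_types.
  rewrite /tau; case: ifP => // _; case: ifP => // H; apply: Ntype.
  by rewrite -index_mem ss H.
have tau_nth i : i < 6 -> tau (nth x0 s i) = if i < 3 then [:: 0; 1; 2] else [:: 3; 4; 5].
  by move=> i6; rewrite /tau index_uniq ?ss // i6.
have mN w i : (i \in N w) = (i < 6) && e (nth x0 s i) w.
  by rewrite mem_filter mem_iota /= andbC.
have nthP6 y : y \in s -> exists2 i, i < 6 & y = nth x0 s i.
  by move=> ys; exists (index y s); rewrite ?nth_index // -[6]ss index_mem.
have adj_tau y z : y != z -> e y z = has (mem (tau z)) (tau y).
  have symm u v : has (mem u) v = has (mem v) u :> bool by exact: has_sym.
  have out i w : i < 6 -> w \notin s ->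
      e (nth x0 s i) w = has (mem (tau w)) (tau (nth x0 s i)).
    move=> i6 ws; have := mN w i; rewrite i6 /= => <-; rewrite tau_nth // (tauN w) //.
    move: (Ntype w ws); rewrite !inE => /or3P [] /eqP ->;
      by case: i i6 => [|[|[|[|[|[|i]]]]]].
  move=> yz; have [ys|ys] := boolP (y \in s); have [zs|zs] := boolP (z \in s).
  - move: yz; have [i i6 ->] := nthP6 y ys; have [j j6 ->] := nthP6 z zs.
    rewrite nth_uniq ?ss // !tau_nth // => ij.
    case: s ss M {us N Ntype Nadj tau tauN tau_type tau_nth mN nthP6 out ys zs}
      => [|a1 [|a2 [|a3 [|b1 [|b2 [|b3 [|? ?]]]]]]] // _ M.
    unfold_matches M.
    case: i j i6 j6 ij => [|[|[|[|[|[|i]]]]]] [|[|[|[|[|[|j]]]]]]  //= _ _ _;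
      first [done | by apply/negbTE | by rewrite esym | by rewrite esym; apply/negbTE].
  - by have [i i6 ->] := nthP6 y ys; apply: out.
  - by have [i i6 ->] := nthP6 z zs; rewrite esym symm; apply: out.
  - by rewrite !tauN //; apply: Nadj.
exists [set y | tau y == [:: 0; 1; 2]], [set y | tau y == [:: 3; 4; 5]]; split.
- apply/pred0P => y /=; rewrite !inE; case: eqP => // -> //.
- move=> u v; rewrite !inE; case: eqVneq => [->|uv]; first by rewrite eirr.
  rewrite adj_tau //; move: (tau_type u) (tau_type v); rewrite !inE.
  by move=> /or3P [] /eqP -> /or3P [] /eqP ->.
- apply/card_geqP; exists (take 3 s); split; first exact: take_uniq.
    by rewrite size_takel // ss.
  move=> y /(nthP x0) [i]; rewrite size_takel ?ss // => i3; rewrite nth_take // => <-.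
  by rewrite inE tau_nth ?i3 // (ltn_trans i3).
- apply/card_geqP; exists (drop 3 s); split; first exact: drop_uniq.
    by rewrite size_drop ss.
  move=> y /(nthP x0) [i]; rewrite size_drop ss => i3; rewrite nth_drop => <-.
  by rewrite inE tau_nth; [case: i i3 => [|[|[|i]]] | rewrite -(ltn_add2l 3) in i3].
Qed.

Lemma extremal_structure : isomorphic e C5 \/
  exists lam mu, [/\ 2 <= mu, mu <= lam, lam + mu < #|T| &
    isomorphic e (Kminus #|T| lam mu)].
Proof.
have [|[|[|[|[|//]]]]] := contains_core_patterns.
- by move/not_ind_2K2_K1.
- by move/not_ind_K2_P3.
- by left; apply: isomorphic_C5.
- move=> /clique_join_of_2K3 [A [B [dAB AB A3 B3]]]; right.
  have lt : #|A| + #|B| < #|T|.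
    have [a aA] : exists a, a \in A by apply/card_gt0P; apply: leq_trans A3.
    have [b bB] : exists b, b \in B by apply/card_gt0P; apply: leq_trans B3.
    have bA : b \notin A by rewrite (disjointFl dAB bB).
    (* The end [v] of an edge leaving [A] is not in [B] either, since no edge joins [A] to [B];
       hence the two cliques miss a vertex. *)
    have [u [v [uA vA uv]]] := closed_neq aA bA.
    have vB : v \notin B by move: uv; rewrite AB uA negb_or => /and3P [].
    rewrite -cardsUI (eqP (_ : A :&: B == set0)) ?setI_eq0 // cards0 addn0.
    rewrite -cardsT; apply: proper_card; rewrite properT.
    by apply/eqP => /setP /(_ v); rewrite !inE (negbTE vA) (negbTE vB).
  case/orP: (leq_total #|B| #|A|) => le.
    exists #|A|, #|B|; split=> //; first exact: ltnW.
    exact: isomorphic_Kminus.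
  exists #|B|, #|A|; split=> //; first exact: ltnW.
    by rewrite addnC.
  apply: isomorphic_Kminus; first by rewrite disjoint_sym.
  by move=> u v; rewrite AB orbC.
- by move/not_linked_2K3.
Qed.

End Structure.
End Patterns.

(** * The extremal graphs *)

Section Extremal.
Variables (T : finType) (e : rel T).
Hypotheses (esym : symmetric e) (eirr : irreflexive e) (n3 : 3 <= #|T|).

Lemma local_resolving_adj (S : {set T}) :
  (forall u v, u \in S -> v \in S -> e u v -> exists2 w, w \notin S & e u w != e v w) ->
  local_resolving e (~: S).
Proof.
move=> H; apply/local_resolvingCP => u v uS vS uv.
have [w wS ew] := H u v uS vS uv; exists w => //.
by apply: dist_neq_adj => //; [move: uS | move: vS]; apply: contraTneq => ->.
Qed.

(** Walks to [w] from adjacent twins correspond length by length. *)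
Lemma dist_twins u v w : e u v -> (forall z, z != u -> z != v -> e u z = e v z) ->
  u != w -> v != w -> dist e u w = dist e v w.
Proof.
move=> uv tw uw vw; apply: eq_find => k; elim: k => [|k IH] /=.
  by rewrite (negbTE uw) (negbTE vw).
(* A walk from [a] that starts towards [b] becomes one from [b] through [a] by the induction
   hypothesis; any other first step is shared by the twins. *)
have step a b : e b a -> (forall z, z != a -> z != b -> e a z = e b z) ->
    walkn e k a w = walkn e k b w ->
    [exists z, e a z && walkn e k z w] -> [exists z, e b z && walkn e k z w].
  move=> ba ab E /existsP [z /andP [az zw]].
  case: (eqVneq z b) => [zb|zb].
    by apply/existsP; exists a; rewrite ba E -zb.
  apply/existsP; exists z; rewrite -ab ?az //.
  by apply: contraTneq az => ->; rewrite eirr.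
apply/idP/idP; first by apply: step; rewrite // esym.
by apply: step => // z zv zu; rewrite tw.
Qed.

Lemma C5_local_metric_dim : isomorphic e C5 -> local_metric_dim e = #|T| - 3.
Proof.
case=> f [[g fK gK] fe].
have ge i j : e (g i) (g j) = C5 i j by rewrite -fe !gK.
have gI := can_inj gK.
apply/eqP; rewrite eqn_leq; apply/andP; split.
  (* Three consecutive vertices: each of the two edges is separated by vertex 3 or vertex 4. *)
  pose S0 := [set i : 'I_5 | i < 3].
  apply: (local_metric_dim_leC (S := g @: S0)); last first.
    by rewrite card_imset // -sum1dep_card big_mkcond !big_ord_recl big_ord0.
  apply: local_resolving_adj => _ _ /imsetP [i i3 ->] /imsetP [j j3 ->].
  rewrite !inE in i3 j3; rewrite ge => ij.
  have [w w3 ew] : exists2 w : 'I_5, 3 <= w & C5 i w != C5 j w.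
    case: i j i3 j3 ij => [[|[|[|i]]] ?] [[|[|[|j]]] ?] // _ _ _;
      first [by exists (Ordinal (isT : 3 < 5)) | by exists (Ordinal (isT : 4 < 5))].
  exists (g w); rewrite ?ge // mem_imset // inE -leqNgt //.
apply: local_metric_dim_geC => S S4; apply/negP => /local_resolvingCP res.
have cT : #|T| = 5 by rewrite (bij_eq_card (f := f)) ?card_ord //; exists g.
have /cards1P [w0 Sw0] : #|~: S| == 1 by rewrite cardsCs setCK cT S4.
have inS z : (z \in S) = (z != w0).
  by rewrite -[S]setCK Sw0 !inE.
have [w gw] : exists w, g w = w0 by exists (f w0).
(* The only possible separator is the omitted vertex [w]. The opposite edge [i j] has both ends at
   distance 2 from it, through [a] and [b]. *)
have [i [j [a [b P]]]] : exists i j a b : 'I_5,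
  [&& C5 i j, i != w, j != w, ~~ C5 i w, ~~ C5 j w, C5 i a, C5 a w, C5 j b & C5 b w].
  pose o (i : 'I_5) k : 'I_5 := Ordinal (ltn_pmod (i + k) (isT : 0 < 5)).
  by exists (o w 2), (o w 3), (o w 1), (o w 4); case: w {gw} => [[|[|[|[|[|w]]]]] ?].
case/and5P: P => ij iw jw niw /and5P [njw ia aw jb bw].
have [|||z] := res (g i) (g j); rewrite ?inS -?gw ?(inj_eq gI) ?ge //.
rewrite negbK => /eqP ->; rewrite !distE // !(inj_eq gI) (negbTE iw) (negbTE jw).
rewrite !ge (negbTE niw) (negbTE njw).
rewrite !ifT ?eqxx //; apply/existsP; first by exists (g b); rewrite !ge jb.
by exists (g a); rewrite !ge ia.
Qed.

Lemma Kminus_local_metric_dim lam mu :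
  2 <= mu -> mu <= lam -> lam + mu < #|T| ->
  isomorphic e (Kminus #|T| lam mu) -> local_metric_dim e = #|T| - 3.
Proof.
move=> mu2 lm lt [f [[g fK gK] fe]].
have gI := can_inj gK.
have l2 : 2 <= lam by apply: leq_trans lm.
apply/eqP; rewrite eqn_leq; apply/andP; split.
  have a_lt : 0 < #|T| by apply: leq_trans lt.
  have a'_lt : 1 < #|T| by apply: leq_trans n3.
  have b_lt : lam < #|T| by apply: leq_ltn_trans lt; apply: leq_addr.
  have b'_lt : lam.+1 < #|T|.
    by apply: ltn_trans lt; rewrite -addn1 ltn_add2l.
  (* Two vertices from each part of the deleted bipartite graph, and [c] adjacent to everything. In
     {a, b, c} the pair [a b] is not adjacent, [a'] separates [b c] and [b'] separates [a c]. *)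
  pose a := Ordinal a_lt; pose a' := Ordinal a'_lt; pose b := Ordinal b_lt.
  pose b' := Ordinal b'_lt; pose c := Ordinal lt.
  have ge i j : e (g i) (g j) = Kminus #|T| lam mu i j by rewrite -fe !gK.
  have l0 : 0 < lam by apply: ltnW.
  have lm0 : 0 < lam + mu by rewrite addn_gt0 l0.
  have llm : lam < lam + mu by rewrite -[X in X < _]addn0 ltn_add2l ltnW.
  have lSlm : lam.+1 < lam + mu by rewrite -addn1 ltn_add2l.
  have lml : lam + mu < lam = false by rewrite ltnNge leq_addr.
  pose S := [set x in map g [:: a; b; c]].
  have inS i : (g i \in S) = (i \in [:: a; b; c]) by rewrite inE mem_map.
  apply: (local_metric_dim_leC (S := S)); last first.
    rewrite cardsE (card_uniqP _) // map_inj_uniq //= !inE -!val_eqE /=.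
    by rewrite !negb_or !neq_ltn l0 lm0 llm.
  have a'S : g a' \notin S.
    by rewrite inS !inE -!val_eqE /= !negb_or !neq_ltn l2 (ltn_trans l2 llm).
  have b'S : g b' \notin S.
    by rewrite inS !inE -!val_eqE /= !negb_or !neq_ltn ltnS leqnn lSlm orbT.
  have ab : e (g a) (g b) = false.
    by rewrite ge /Kminus /= l0 leqnn llm andbF.
  have bc : e (g b) (g a') != e (g c) (g a').
    by rewrite !ge /Kminus -!val_eqE /= l2 leqnn llm ltnn lml orbT ltnn !andbF andbT
      neq_ltn (ltn_trans l2 llm) orbT.
  have ac : e (g a) (g b') != e (g c) (g b').
    by rewrite !ge /Kminus -!val_eqE /= l0 leqnSn lSlm lml ltnn !andbF andbT
      neq_ltn lSlm orbT.
  apply: local_resolving_adj => u v; rewrite !inE.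
  by move=> /or3P [] /eqP -> /or3P [] /eqP ->; rewrite ?eirr ?ab 1?esym ?ab // => _;
    first [by exists (g a'); rewrite // eq_sym | by exists (g b'); rewrite // eq_sym].
apply: local_metric_dim_geC => S S4; apply/negP => /local_resolvingCP res.
(* Counting the thresholds passed gives 0, 1, 2 for the two parts and the rest. Among four vertices
   two share a value; they are adjacent twins, which no third vertex distinguishes. *)
pose part x : 'I_3 := inord ((lam <= f x) + (lam + mu <= f x)).
have [p /and4P [uS vS uv /eqP E]|no] := pickP (fun p : T * T =>
  [&& p.1 \in S, p.2 \in S, p.1 != p.2 & part p.1 == part p.2]); last first.
  have inj : {in S &, injective part}.
    move=> x y xS yS E; apply/eqP; apply: contraT => xy.
    by have := no (x, y); rewrite /= xS yS xy E eqxx.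
  by have := max_card (mem (part @: S)); rewrite card_in_imset // S4 card_ord.
move: p => [u v] /= in uS vS uv E.
have [E1 E2] : (f u < lam) = (f v < lam) /\ (f u < lam + mu) = (f v < lam + mu).
  have mono x : lam + mu <= x -> lam <= x by apply: leq_trans; apply: leq_addr.
  have lt3 (x y : bool) : x + y < 3 by case: x y => [] [].
  have := congr1 val E; rewrite /= !inordK // !ltnNge.
  move: (mono (f u)) (mono (f v)).
  by do 4!case: (_ <= _) => //; move=> H1 H2; do [have := H1 isT | have := H2 isT].
have euv : e u v.
  rewrite -fe /Kminus (inj_eq (can_inj fK)) uv /= !(leqNgt lam) E1 E2.
  by case: (_ < lam); rewrite /= ?andbF.
have [w wS /negP] := res u v uS vS euv; apply; apply/eqP; apply: dist_twins => //.
- move=> z zu zv; rewrite -!fe /Kminus !(inj_eq (can_inj fK)) ![_ == z]eq_sym zu zv.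
  by rewrite !(leqNgt lam) E1 E2.
- by apply: contraNneq wS => <-.
- by apply: contraNneq wS => <-.
Qed.

End Extremal.

(** * The bound and the case of equality *)

Theorem theorem2p2 (T : finType) (e : rel T)
  (esym : symmetric e) (eirr : irreflexive e)
  (hconn : connected_graph e)
  (hn : 5 <= #|T|)
  (hw : clique_number e <= #|T| - 3) :
  local_metric_dim e <= #|T| - 3 /\
  (local_metric_dim e = #|T| - 3 <->
     (isomorphic e C5 \/
      exists lam mu : nat,
        [/\ 2 <= mu, mu <= lam, lam + mu < #|T| &
            isomorphic e (Kminus #|T| lam mu)])).
Proof.
have n3 : 3 <= #|T| by apply: leq_trans hn.
have extremal_dim : isomorphic e C5 \/ (exists lam mu : nat,
    [/\ 2 <= mu, mu <= lam, lam + mu < #|T| & isomorphic e (Kminus #|T| lam mu)]) ->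
    local_metric_dim e = #|T| - 3.
  case=> [|[lam [mu [mu2 le lt iso]]]]; first exact: C5_local_metric_dim.
  exact: Kminus_local_metric_dim iso.
have /card_gt0P [x0 _] : 0 < #|T| by apply: leq_trans hn.
(* A good set of size at least 4 makes the bound strict, and then [extremal_dim] excludes the
   extremal graphs; without one the structure lemma applies. *)
have [S /andP [resS S4]|small] :=
    pickP (fun S : {set T} => local_resolving e (~: S) && (4 <= #|S|)).
  have lt : local_metric_dim e < #|T| - 3.
    apply: leq_ltn_trans (local_metric_dim_leC resS S4) _.
    by rewrite ltn_sub2l // (leq_trans _ hn).
  split; first exact: ltnW.
  by split=> [E|/extremal_dim E]; rewrite E ltnn in lt.
have structure : isomorphic e C5 \/ exists lam mu : nat,
    [/\ 2 <= mu, mu <= lam, lam + mu < #|T| & isomorphic e (Kminus #|T| lam mu)].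
  apply: (extremal_structure esym eirr _ x0 hn hw hconn) => S resS.
  by rewrite leqNgt; have := small S; rewrite resS /= => ->.
by rewrite (extremal_dim structure).
Qed.
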